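(* Let $K$ be a field and $S=K[x_1,\dots,x_n]$. For a matroidal ideal $I\subset S$ the following conditions are equivalent: (a) $I=P_{F_1}\cdots P_{F_t}$ with $F_i\cap F_j=\emptyset$ for all $i\neq j$. (b) $I^{(k)}=I^k$ for all $k\ge1$. (c) $I$ is packed.
   Context: For a non-empty subset $F$ of $\{1,\dots,n\}$, $P_F=(x_i:\ i\in F)$. The $k$th symbolic power of $I$ is $I^{(k)}=\bigcap_{P\in\mathrm{Ass}(I)}(I^kS_P\cap S)$, where $\mathrm{Ass}(I)$ is the set of associated prime ideals of $I$ (that is, of $S/I$). Let $\mathcal{G}(I)$ be the set of minimal monomial generators of a monomial ideal $I$, and let $\deg_{x_i}(u)$ be the exponent of $x_i$ in a monomial $u$. A monomial ideal $I\subset S$ is polymatroidal if it is generated in a single degree and for all $u,v\in\mathcal{G}(I)$ with $\deg_{x_i}(u)>\deg_{x_i}(v)$ for some $i$, there exists $j$ with $\deg_{x_j}(u)<\deg_{x_j}(v)$ such that $x_j(u/x_i)\in\mathcal{G}(I)$. The zero ideal is regarded as a polymatroidal ideal. A squarefree polymatroidal ideal is called matroidal. A squarefree monomial ideal $I\subset S$ is König if it contains a monomial regular sequence of length $\mathrm{height}(I)$. It is packed if every ideal obtained from $I$ by setting a (possibly empty) subset of the variables equal to $0$ and a disjoint (possibly empty) subset of the variables equal to $1$ is König.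
   Formalization: The matroidal ideal I is assumed nonzero, since I = 0 satisfies (b) and (c) but is not a product of P_F with F non-empty; t = 0 (empty product S) is allowed in (a), and the unit ideal is counted as König. *)

(* Defs.v *)
From mathcomp Require Import all_boot all_order all_algebra.
From mathcomp Require Import mpoly.

Set Implicit Arguments.
Unset Strict Implicit.
Unset Printing Implicit Defensive.

Import GRing.Theory.
Local Open Scope ring_scope.

(* Sets of polynomials are Prop-valued predicates: the [idealr_closed] of
   mathcomp's ring_quotient is boolean and excludes the unit ideal. *)
Section Ideals.
Variables (K : fieldType) (n : nat).
Local Notation S := {mpoly K[n]}.
Implicit Types (A I J P : S -> Prop) (f g : S).

Definition incl A I : Prop := forall f, A f -> I f.
Definition ideal_eq I J : Prop := forall f, I f <-> J f.

Definition is_ideal I : Prop :=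
  [/\ I 0, forall f g, I f -> I g -> I (f + g) & forall f g, I g -> I (f * g)].

Definition ideal_gen A : S -> Prop := fun f =>
  exists s : seq (S * S),
    (forall p, p \in s -> A p.2) /\ f = \sum_(p <- s) p.1 * p.2.

Definition unit_ideal : S -> Prop := fun _ => True.

Definition ideal_mul I J : S -> Prop :=
  ideal_gen (fun h => exists f g, [/\ I f, J g & h = f * g]).

Definition ideal_exp I (k : nat) : S -> Prop :=
  iter k (ideal_mul I) unit_ideal.

Definition is_prime P : Prop :=
  [/\ is_ideal P, ~ P 1 & forall f g, P (f * g) -> P f \/ P g].

Definition var_ideal (F : {set 'I_n}) : S -> Prop :=
  ideal_gen (fun f => exists2 i, i \in F & f = 'X_i).

Definition is_ass I P : Prop :=
  is_prime P /\ exists f, forall g, P g <-> I (g * f).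

(* J S_P \cap S: those f with f/1 in J S_P. *)
Definition loc_contraction J P : S -> Prop := fun f =>
  exists s, ~ P s /\ J (s * f).

Definition symbolic_power I (k : nat) : S -> Prop := fun f =>
  forall P, is_ass I P -> loc_contraction (ideal_exp I k) P f.

(* ht P >= h, for P prime: a strict chain Q 0 < ... < Q h = P of primes. *)
Definition prime_height_ge P (h : nat) : Prop :=
  exists Q : nat -> S -> Prop,
    [/\ forall i, (i <= h)%N -> is_prime (Q i),
        forall i, (i < h)%N -> incl (Q i) (Q i.+1) /\ ~ incl (Q i.+1) (Q i)
      & ideal_eq (Q h) P].

Definition height_ge I (h : nat) : Prop :=
  forall P, is_prime P -> incl I P -> prime_height_ge P h.

(* The unit ideal has no (finite) height in this sense. *)
Definition has_height I (h : nat) : Prop :=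
  height_ge I h /\ ~ height_ge I h.+1.

Definition ideal_of_seq (s : seq S) : S -> Prop := ideal_gen (fun f => f \in s).

Definition regular_sequence (s : seq S) : Prop :=
  (forall i, (i < size s)%N ->
     forall g, ideal_of_seq (take i s) (s`_i * g) ->
       ideal_of_seq (take i s) g)
  /\ ~ ideal_of_seq s 1.

Definition monomial_ideal I : Prop :=
  exists M : 'X_{1..n} -> Prop,
    ideal_eq I (ideal_gen (fun f => exists2 m, M m & f = 'X_[m])).

(* G(I): the monomials of I that are minimal for divisibility, which is the
   componentwise order on exponents. *)
Definition min_gen I (u : 'X_{1..n}) : Prop :=
  I 'X_[u] /\ forall v : 'X_{1..n}, I 'X_[v] -> (v <= u)%MM -> v = u.

Definition squarefree_monomial_ideal I : Prop :=
  monomial_ideal I /\ forall u, min_gen I u -> forall i, (u i <= 1)%N.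

(* The zero ideal qualifies, having no minimal generators. *)
Definition polymatroidal I : Prop :=
  [/\ monomial_ideal I,
      exists d : nat, forall u, min_gen I u -> mdeg u = d
    & forall u v i, min_gen I u -> min_gen I v -> (v i < u i)%N ->
        exists2 j, (u j < v j)%N & min_gen I (u - U_(i) + U_(j))%MM].

Definition matroidal I : Prop :=
  polymatroidal I /\ squarefree_monomial_ideal I.

(* The unit ideal, which arises by setting variables to 1, is Koenig by
   convention. *)
Definition konig I : Prop :=
  I 1 \/
  exists h, has_height I h /\
    exists s : seq 'X_{1..n},
      [/\ size s = h, forall m, m \in s -> I 'X_[m]
        & regular_sequence [seq 'X_[m] | m <- s]].

Definition set_vars (Z W : {set 'I_n}) (f : S) : S :=
  f \mPo [tuple if i \in Z then 0 else if i \in W then 1 else 'X_i | i < n].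

(* The substituted ideal is extended back to S; adjoining the eliminated
   variables changes neither the height nor the Koenig property. *)
Definition set_vars_ideal (Z W : {set 'I_n}) I : S -> Prop :=
  ideal_gen (fun g => exists2 f, I f & g = set_vars Z W f).

Definition packed I : Prop :=
  forall Z W : {set 'I_n}, [disjoint Z & W] -> konig (set_vars_ideal Z W I).

End Ideals.

(* Main.v *)
Require Import Defs.
From mathcomp Require Import all_boot all_order all_algebra.
From mathcomp Require Import mpoly.
From mathcomp Require Import zify ring.
From Stdlib Require Import Classical ClassicalEpsilon.

Set Implicit Arguments.
Unset Strict Implicit.
Unset Printing Implicit Defensive.

(** A nonzero matroidal ideal I is the ideal of the bases of a matroid: f lies
    in I exactly when the support of every monomial of f contains a basis
    ([matroidal_bases]).  Being a product of monomial primes in disjoint sets of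
    variables means that, apart from loops, the matroid is a direct sum of
    matroids of rank one: its bases are the transversals of disjoint sets
    F_1, ..., F_t.  This fails exactly when the matroid has a minor U_{2,3}, that
    is, when for some basis B and some e outside B two different elements a, b of
    B can be exchanged for e.  If it never happens, then the sets of elements
    parallel to b, for b in a fixed basis, are such F_i
    ([triangle_free_disjoint_product]).

    The minor contradicts both other conditions.  Put W = B \ {a, b} and let d
    be the rank.  The monomial x_W^2 x_a x_b x_e lies in the second symbolic
    power, because every associated prime contains two of its factors, while its
    degree 2d - 1 is too small for I^2 ([symbolic_triangle_free]).  Setting the
    variables of W to 1 and those outside B and e to 0 turns I into
    (x_a x_b, x_a x_e, x_b x_e), an ideal of height 2 in which no two monomials
    are coprime, hence without a monomial regular sequence of length 2
    ([packed_triangle_free]).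

    Conversely let I be the product of the P_{F_i}.  Membership in I^k is the
    condition that every monomial has degree at least k in the variables of each
    F_i; each P_{F_i} is associated to I, and localizing at it cannot lower the
    degree in F_i, so the symbolic powers satisfy the same condition
    ([disjoint_product_symbolic]).  Setting variables to 0 and 1 yields again a
    product of such primes, with sets G_i.  Its height is h = min |G_i|, and
    multiplying the j-th elements of all the G_i, for j < h, gives h pairwise
    coprime monomials in it ([disjoint_product_packed]).

    The height computation needs ht P_F = |F|.  For the upper bound a chain of
    primes below P_F is continued by adding the other variables, so that it
    suffices to see that K[x_1, ..., x_n] has no chain of n + 1 strict inclusions
    of primes.  Choose, in each step of a chain of length h, an element of the
    larger prime outside the smaller one.  Products of powers of these elements,
    with exponents less than D, are D^h linearly independent polynomials of degree
    at most eD, with e constant.  There are at most (eD + 1)^n monomials of such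
    degrees, so h <= n ([prime_height_le_nvars]). *)

(** * Bases of a matroid without a minor U_{2,3} *)

Section MatroidBases.
Variables (T : finType) (Bs : {set {set T}}).

Definition exchange := forall A B x,
  A \in Bs -> B \in Bs -> x \in A -> x \notin B ->
  exists2 y, y \in B :\: A & y |: (A :\ x) \in Bs.

(** No minor U_{2,3}: contracting B minus a and b would otherwise make
    a, b, e a circuit with three elements. *)
Definition triangle_free := forall B e a b, B \in Bs -> e \notin B ->
  a \in B -> b \in B ->
  e |: (B :\ a) \in Bs -> e |: (B :\ b) \in Bs -> a = b.

Hypothesis exch : exchange.
Hypothesis card_bases : {in Bs &, forall A B : {set T}, #|A| = #|B|}.

(** Here c enters A, whereas [exchange] removes a given element.  Exchanging the
    elements of D outside A, except c, for elements of A leads to the case where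
    D is A with one element replaced by c. *)
Lemma dual_exchange A D c : A \in Bs -> D \in Bs -> c \in D -> c \notin A ->
  exists2 a, a \in A :\: D & c |: (A :\ a) \in Bs.
Proof.
move=> AB; move: {2}_.+1 (ltnSn #|D :\: A|) => N.
elim: N D => // N IH D leN DB cD cA.
have [/existsP[d /andP[]]|none] := boolP [exists d, (d \in D :\: A) && (d != c)].
  rewrite inE => /andP[dA dD] dc; have [y] := exch DB AB dD dA.
  rewrite inE => /andP[yD yA] D'B; have [||a] := IH _ _ D'B _ cA.
  - apply: leq_trans (_ : #|D :\: A| <= N); last by [].
    apply: proper_card; apply/properP; split.
      apply/subsetP=> z; rewrite !inE; case: eqP => [->|_]; rewrite ?yA //=.
      by move=> /and3P[-> _ ->].
    by exists d; rewrite !inE ?dA ?dD // eqxx /= orbF; apply: contraNneq yD => <-.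
  - by rewrite !inE (eq_sym c d) dc cD orbT.
  - rewrite inE => /andP[aD' aA] aB; exists a => //; rewrite !inE aA andbT.
    apply: contra aD' => aD; rewrite !inE aD andbT; apply/orP; right.
    by apply: contraNneq dA => <-.
have DA : D :\: A = [set c].
  apply/setP=> z; rewrite in_set1; apply/idP/eqP=> [zDA|->]; last by rewrite inE cA.
  by apply/eqP; apply: contraNT none => zc; apply/existsP; exists z; rewrite zDA.
have cAD : #|A :\: D| = 1.
  have := cardsID D A; have := cardsID A D; rewrite DA cards1 setIC (card_bases DB AB).
  by move=> <- /addnI.
have /cards1P[a aE] : #|A :\: D| == 1 by rewrite cAD.
exists a; first by rewrite aE set11.
suff -> : c |: (A :\ a) = D by [].
(* A and D differ by a and c only, as seen from the two differences. *)
apply/setP=> z; move/setP/(_ z): aE; move/setP/(_ z): DA; rewrite !inE.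
by case: (z == c); case: (z == a); case: (z \in A); case: (z \in D).
Qed.

Hypothesis noT : triangle_free.
Variable B0 : {set T}.
Hypothesis B0B : B0 \in Bs.

(** When no minor U_{2,3} exists, exchangeability for b characterizes, for e
    outside B0, the elements parallel to b. *)
Definition parallel_class b := [set e | e |: (B0 :\ b) \in Bs].

Lemma mem_parallel_class b : b \in B0 -> b \in parallel_class b.
Proof. by move=> bB; rewrite inE setD1K. Qed.

Lemma parallel_class_basis b e : b \in B0 -> e \in B0 -> e \in parallel_class b -> e = b.
Proof.
move=> bB eB; rewrite inE => eP; apply/eqP/idPn=> eb; have := card_bases eP B0B.
by rewrite cardsU1 !inE eb eB (cardsD1 b B0) bB => /eqP; rewrite eqn_leq ltnn andbF.
Qed.

Lemma parallel_class_inj b b' e : b \in B0 -> b' \in B0 ->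
  e \in parallel_class b -> e \in parallel_class b' -> b = b'.
Proof.
move=> bB b'B eb eb'; have [eB|eB] := boolP (e \in B0).
  by rewrite -(parallel_class_basis bB eB eb) -(parallel_class_basis b'B eB eb').
by move: eb eb'; rewrite !inE; apply: noT.
Qed.

Lemma basis_meets_class A b : A \in Bs -> b \in B0 ->
  exists2 e, e \in A & e \in parallel_class b.
Proof.
move=> AB bB; have [bA|bA] := boolP (b \in A).
  by exists b => //; apply: mem_parallel_class.
by have [y] := exch B0B AB bB bA; rewrite inE => /andP[_ yA] yB; exists y; rewrite ?inE.
Qed.

(** Elements of different classes are not parallel: exchange b' out of the basis
    B0 - b + c for an element of B0 - b' + c'; it cannot be b, which would put c
    in two classes. *)
Lemma classes_independent b b' c c' : b \in B0 -> b' \in B0 -> b != b' ->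
  c \in parallel_class b -> c' \in parallel_class b' ->
  exists D, [/\ D \in Bs, c \in D & c' \in D].
Proof.
move=> bB b'B bb' cb c'b'.
have := cb; have := c'b'; rewrite !inE => vB uB.
have [c'E|c'N] := eqVneq c' b'.
  by exists (c |: (B0 :\ b)); split; rewrite // !inE ?eqxx // c'E [b' == b]eq_sym bb' b'B orbT.
have b'u : b' \in c |: (B0 :\ b) by rewrite !inE [b' == b]eq_sym bb' b'B orbT.
have b'v : b' \notin c' |: (B0 :\ b') by rewrite !inE eqxx /= orbF eq_sym.
have cb' : c != b'.
  apply: contraNneq bb' => cE; apply/eqP; apply: (parallel_class_inj bB b'B cb).
  by rewrite cE mem_parallel_class.
have [j] := exch uB vB b'u b'v; rewrite !inE negb_or => /andP[/andP[jc jN] jv] jB.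
have [jc'|jc'] := eqVneq j c'.
  exists (j |: ((c |: (B0 :\ b)) :\ b')); split=> //; last by rewrite jc' !inE eqxx.
  by rewrite !inE cb' eqxx /= orbT.
move: jv jN; rewrite (negPf jc') /= => /andP[jb' jB0]; rewrite jB0 andbT negbK => /eqP jb.
suff bb : b = b' by rewrite bb eqxx in bb'.
apply: (parallel_class_inj bB b'B cb); rewrite inE.
suff <- : j |: ((c |: (B0 :\ b)) :\ b') = c |: (B0 :\ b') by [].
rewrite jb; apply/setP=> z; rewrite !inE.
have [->|zb'] := eqVneq z b'; first by rewrite [b' == b]eq_sym (negPf bb') eq_sym (negPf cb').
by have [->|zb] := eqVneq z b; rewrite ?bB ?orbT.
Qed.

(** A basis A with the largest possible part in the transversal contains it.
    Otherwise some c b enters A in exchange for an element a, unique by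
    [triangle_free].  If a is outside the transversal, A was not optimal; if it
    is some c b', then a basis containing both c b and c b' allows another
    exchange, by [dual_exchange]. *)
Lemma transversal_basis (c : T -> T) :
  (forall b, b \in B0 -> c b \in parallel_class b) -> c @: B0 \in Bs.
Proof.
move=> cP.
have c_inj : {in B0 &, injective c}.
  move=> b b' bB b'B cc; apply: (parallel_class_inj bB b'B (cP _ bB)).
  by rewrite cc; apply: cP.
have cC : #|c @: B0| = #|B0| by rewrite card_in_imset.
case: (arg_maxnP (fun A : {set T} => #|A :&: c @: B0|) B0B) => A AB Amax.
have [sub|/subsetPn[_ /imsetP[b bB ->] cA]] := boolP (c @: B0 \subset A).
  suff -> : c @: B0 = A by [].
  by apply/eqP; rewrite eqEcard sub cC (card_bases AB B0B) leqnn.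
have Db := cP b bB; rewrite inE in Db.
have [|a] := dual_exchange AB Db _ cA; first by rewrite !inE eqxx.
rewrite inE => /andP[_ aA] aB.
have [aC|aC] := boolP (a \in c @: B0); last first.
  have := Amax _ aB; rewrite /= leqNgt => /negP[]; apply: proper_card; apply/properP; split.
    apply/subsetP=> z; rewrite !inE => /andP[zA zC]; rewrite zA zC !andbT.
    by apply/orP; right; apply: contraNneq aC => <-.
  by exists (c b); rewrite !inE ?eqxx ?(negPf cA) //= imset_f.
have /imsetP[b' b'B aE] := aC.
have bb' : b != b' by apply: contraNneq cA => bb'; rewrite bb' -aE.
have [D [DB cD c'D]] := classes_independent bB b'B bb' (cP _ bB) (cP _ b'B).
have [a'] := dual_exchange AB DB cD cA; rewrite inE => /andP[a'D a'A] a'B.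
have aa' : a = a' := noT AB cA aA a'A aB a'B.
by rewrite -aa' aE c'D in a'D.
Qed.

End MatroidBases.
Import GRing.Theory.
Local Open Scope ring_scope.

(** * Ideals determined by the exponents of monomials *)

Section Monomials.
Variables (K : fieldType) (n : nat).
Local Notation S := {mpoly K[n]}.
Implicit Types (I J P : S -> Prop) (f g s : S) (m u : 'X_{1..n}) (F : {set 'I_n}).

Lemma ideal_gen_ideal (A : S -> Prop) : is_ideal (ideal_gen A).
Proof.
split=> [|f g [s [sA ->]] [t [tA ->]]|f g [s [sA ->]]].
- by exists [::]; rewrite big_nil.
- exists (s ++ t); rewrite big_cat; split=> // p.
  by rewrite mem_cat => /orP[/sA|/tA].
- exists [seq (f * p.1, p.2) | p <- s]; split=> [p /mapP[q qs ->]|]; first exact: (sA q).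
  by rewrite big_map mulr_sumr; apply: eq_bigr => p _; rewrite mulrA.
Qed.

Lemma mem_ideal_gen (A : S -> Prop) f : A f -> ideal_gen A f.
Proof.
by exists [:: (1, f)]; rewrite big_seq1 mul1r; split=> // p; rewrite inE => /eqP->.
Qed.

Lemma ideal_sum J (T : eqType) (r : seq T) (G : T -> S) :
  is_ideal J -> (forall x, x \in r -> J (G x)) -> J (\sum_(x <- r) G x).
Proof.
by move=> [J0 JD _] JG; rewrite big_seq; elim/big_ind: _.
Qed.

Lemma ideal_gen_min (A : S -> Prop) J :
  is_ideal J -> incl A J -> incl (ideal_gen A) J.
Proof.
move=> Jid AJ f [s [sA ->]]; apply: ideal_sum => // p ps.
by case: Jid => _ _; apply; apply/AJ/sA.
Qed.

(** For U closed under multiplication by monomials, this is the ideal spanned by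
    the monomials in U; monomial ideals are handled in this form. *)
Definition supp_in (U : 'X_{1..n} -> Prop) f := forall m, m \in msupp f -> U m.

Lemma supp_in_ideal (U : 'X_{1..n} -> Prop) :
  (forall m u, U u -> U (m + u)%MM) -> is_ideal (supp_in U).
Proof.
move=> Uup; split=> [m|f g Uf Ug m|f g Ug m]; first by rewrite msupp0.
  by move/msuppD_le; rewrite mem_cat => /orP[/Uf|/Ug].
by move/msuppM_le => /allpairsP[[m1 m2] /= [_ /Ug Um2 ->]]; apply: Uup.
Qed.

Lemma supp_inX (U : 'X_{1..n} -> Prop) m : supp_in U 'X_[m] <-> U m.
Proof.
by split=> [|Um u]; [apply; rewrite msuppX inE | rewrite msuppX inE => /eqP->].
Qed.

Lemma ideal_monomials J f :
  is_ideal J -> supp_in (fun m => J 'X_[m]) f -> J f.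
Proof.
move=> Jid fJ; rewrite (mpolyE f); apply: ideal_sum => // m /fJ mJ.
by rewrite -mul_mpolyC; case: Jid => _ _; apply.
Qed.

Lemma ideal_X_le J m u : is_ideal J -> (u <= m)%MM -> J 'X_[u] -> J 'X_[m].
Proof. by move=> [_ _ JM] um Ju; rewrite -(submK um) mpolyXD; apply: JM. Qed.

Lemma ideal_gen_monomials (M : 'X_{1..n} -> Prop) (A : S -> Prop) f :
  (forall g, A g <-> exists2 m, M m & g = 'X_[m]) ->
  (ideal_gen A f <-> supp_in (fun m => exists2 u, M u & (u <= m)%MM) f).
Proof.
move=> AM; split.
  apply: ideal_gen_min => [|_ /AM[m Mm ->]]; last by apply/supp_inX; exists m; rewrite ?lepm_refl.
  apply: supp_in_ideal => m u [v Mv vu]; exists v => //.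
  by apply: lepm_trans vu _; apply: lem_addl.
move=> fM; apply: ideal_monomials => [|m /fM[u Mu um]]; first exact: ideal_gen_ideal.
apply: ideal_X_le um _; first exact: ideal_gen_ideal.
by apply/mem_ideal_gen/AM; exists u.
Qed.

Definition fdeg F m := (\sum_(i in F) m i)%N.

Lemma fdegD F m u : fdeg F (m + u)%MM = (fdeg F m + fdeg F u)%N.
Proof. by rewrite /fdeg -big_split; apply: eq_bigr => i _; rewrite mnmDE. Qed.

Lemma fdegT m : fdeg setT m = mdeg m.
Proof. by rewrite mdegE; apply: eq_bigl => i; rewrite inE. Qed.

Lemma fdeg_gt0 F m : reflect (exists2 i, i \in F & m i != 0%N) (0 < fdeg F m)%N.
Proof.
rewrite lt0n sum_nat_eq0; apply: (iffP forall_inPn) => -[i]; exists i => //.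
Qed.

Lemma fdeg1 F i : fdeg F U_(i)%MM = (i \in F).
Proof.
have [iF|iF] := boolP (i \in F).
  rewrite /fdeg (bigD1 i) //= mnm1E eqxx big1 ?addn0 // => j /andP[_ ji].
  by rewrite mnm1E eq_sym (negPf ji).
rewrite /fdeg big1 // => j jF; rewrite mnm1E; case: eqP => // ij.
by rewrite ij jF in iF.
Qed.

(** The k-th power of the prime generated by the variables of F. *)
Definition deg_ge F k := supp_in (fun m => (k <= fdeg F m)%N).

Lemma deg_ge_ideal F k : is_ideal (deg_ge F k).
Proof. by apply: supp_in_ideal => m u ku; rewrite fdegD (leq_trans ku) ?leq_addl. Qed.

Lemma deg_geM F j k f g : deg_ge F j f -> deg_ge F k g -> deg_ge F (j + k) (f * g).
Proof.
by move=> fj gk m /msuppM_le /allpairsP[[m1 m2] /= [/fj ? /gk ? ->]]; rewrite fdegD leq_add.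
Qed.

Lemma var_ideal_deg F f : var_ideal F f <-> deg_ge F 1 f.
Proof.
rewrite /var_ideal (@ideal_gen_monomials (fun m => exists2 i, i \in F & m = U_(i)%MM)).
  split=> fF m /fF.
    by case=> _ [i iF ->]; rewrite lep1mP => mi; apply/fdeg_gt0; exists i.
  by case/fdeg_gt0=> i iF mi; exists U_(i)%MM; [exists i | rewrite lep1mP].
by move=> g; split=> [[i iF ->]|[_ [i iF ->] ->]]; [exists U_(i)%MM => //; exists i | exists i].
Qed.

Definition restrict (p : pred 'X_{1..n}) f : S := \sum_(m <- msupp f | p m) f@_m *: 'X_[m].

Lemma restrict_split (p : pred 'X_{1..n}) f : f = restrict p f + restrict (predC p) f.
Proof. by rewrite {1}(mpolyE f) (bigID p). Qed.

Lemma restrict_supp (p : pred 'X_{1..n}) f : supp_in (fun m => p m /\ m \in msupp f) (restrict p f).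
Proof.
move=> m /msupp_sum_le /flatten_mapP[u]; rewrite mem_filter => /andP[pu uf].
by move/msuppZ_le; rewrite msuppX inE => /eqP->.
Qed.

(** The powers of the prime P_F are P_F-primary: by induction on k the terms of
    f have degree at least k in F, and the part of degree k of s * f is the
    product of the part s0 of degree 0 of s, which is not zero, by the part f0 of
    degree k of f. *)
Lemma deg_ge_cancel F k s f : ~ deg_ge F 1 s -> deg_ge F k (s * f) -> deg_ge F k f.
Proof.
move=> sN; elim: k => [|k IH] sf; first by move=> m.
have fk : deg_ge F k f by apply: IH => m /sf; apply: ltnW.
have [_ addI mulI] := deg_ge_ideal F k.+1.
pose s0 := restrict (fun m => fdeg F m == 0)%N s.
pose f0 := restrict (fun m => fdeg F m == k)%N f.
have sE : s = s0 + _ := restrict_split _ s.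
have fE : f = f0 + _ := restrict_split _ f.
set s1 := restrict _ s in sE; set f1 := restrict (predC _) f in fE.
have s1ge : deg_ge F 1 s1 by move=> m /restrict_supp[/= + _]; rewrite lt0n.
have f1ge : deg_ge F k.+1 f1.
  by move=> m /restrict_supp[/= + /fk]; rewrite ltn_neqAle eq_sym => ->.
have s0N : s0 != 0 by apply/eqP=> s00; apply: sN; rewrite sE s00 add0r.
have s0f0 : deg_ge F k.+1 (s0 * f0).
  have -> : s0 * f0 = s * f + (- 1) * (f0 * s1) + (- s) * f1.
    apply/eqP; rewrite eq_sym !mulNr mul1r !subr_eq (mulrC f0) addrAC.
    by rewrite -mulrDl -sE -mulrDr -fE.
  apply: (addI); last exact: mulI.
  apply: (addI) => //; apply: (mulI); rewrite -addn1; apply: deg_geM => // m.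
  by move=> /restrict_supp[/eqP-> _].
have f00 : f0 = 0.
  apply/eqP; apply/idPn => f0N; have := mulf_neq0 s0N f0N; rewrite -msupp_eq0.
  case E: (msupp (s0 * f0)) => [//|m r] _; have mm : m \in msupp (s0 * f0) by rewrite E mem_head.
  have := s0f0 m mm; have /allpairsP[[m1 m2] /= [+ + ->]] := msuppM_le mm.
  by move=> /restrict_supp[/eqP E1 _] /restrict_supp[/eqP E2 _]; rewrite fdegD E1 E2 add0n ltnn.
by rewrite fE f00 add0r.
Qed.
End Monomials.

(** * Heights of primes generated by variables *)

Section Heights.
Variables (K : fieldType) (n : nat).
Local Notation S := {mpoly K[n]}.
Implicit Types (I J P Q : S -> Prop) (f g s : S) (m u : 'X_{1..n}) (F : {set 'I_n}).

Lemma prime_ideal P : is_prime P -> is_ideal P.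
Proof. by case. Qed.

Lemma ideal_addK J f g : is_ideal J -> J (f + g) -> J g -> J f.
Proof.
move=> [_ JD JM] Jfg Jg; have -> : f = f + g + (-1) * g by rewrite mulN1r addrK.
by apply: (JD) => //; apply: JM.
Qed.

Lemma prime_prod P (T : finType) (A : {set T}) (G : T -> S) :
  is_prime P -> P (\prod_(i in A) G i) -> exists2 i, i \in A & P (G i).
Proof.
move=> [_ P1 PM]; rewrite -big_enum /=.
have : forall i, i \in enum A -> i \in A by move=> i; rewrite mem_enum.
elim: (enum A) => [|i r IH] rA; rewrite ?big_nil // big_cons => /PM[Pi|Pr].
  by exists i; rewrite // rA ?mem_head.
by apply: IH => // j jr; apply: rA; rewrite inE jr orbT.
Qed.

Lemma var_ideal_incl F J : is_ideal J -> (forall i, i \in F -> J 'X_i) -> incl (var_ideal F) J.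
Proof. by move=> Jid FJ; apply: ideal_gen_min => // _ [i iF ->]; apply: FJ. Qed.

Lemma var_ideal_var F i : var_ideal F ('X_i : S) <-> i \in F.
Proof. by rewrite var_ideal_deg /deg_ge supp_inX fdeg1; case: (i \in F). Qed.

Lemma var_ideal_prime F : is_prime (var_ideal F : S -> Prop).
Proof.
split; first exact: ideal_gen_ideal.
  by rewrite var_ideal_deg -mpolyX0 /deg_ge supp_inX /fdeg big1 // => i _; rewrite mnm0E.
move=> f g fg; case: (classic (var_ideal F f)) => [|fN]; first by left.
right; move: fg; rewrite !var_ideal_deg; apply: deg_ge_cancel.
by rewrite -var_ideal_deg.
Qed.

Lemma prime_height_geS P P' h : is_prime P' -> incl P P' -> ~ incl P' P ->
  prime_height_ge P h -> prime_height_ge P' h.+1.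
Proof.
move=> P'prime PP' P'P [Q [Qprime Qchain QP]].
exists (fun i => if (i <= h)%N then Q i else P'); split=> [i _|i|f].
- by case: ifP => // /Qprime.
- move=> le_ih; have [lt_ih|ge_ih] := ltnP i h.
    by rewrite (ltnW lt_ih); apply: Qchain.
  have -> : i = h by apply/eqP; rewrite eqn_leq ge_ih -ltnS le_ih.
  rewrite leqnn; split=> [f /QP /PP'|P'Q] //; apply: P'P => f /P'Q.
  by move/QP.
- by rewrite ltnn.
Qed.

(** Adding the variables of F one at a time gives a chain of primes in P. *)
Lemma prime_height_ge_vars P F h : is_prime P -> incl (var_ideal F) P ->
  (h <= #|F|)%N -> prime_height_ge P h.
Proof.
elim: h P F => [|h IH] P F Pprime FP hF; first by exists (fun=> P).
have /set0Pn[i iF] : F != set0 by rewrite -card_gt0; apply: leq_trans hF.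
rewrite (cardsD1 i) iF ltnS in hF.
apply: (@prime_height_geS (var_ideal (F :\ i))) => //.
- apply: var_ideal_incl => [|j]; first exact: prime_ideal.
  by rewrite inE => /andP[_ jF]; apply/FP/var_ideal_var.
- move/(_ 'X_i (FP _ _)) => iN; have /iN/var_ideal_var : var_ideal F ('X_i : S) by apply/var_ideal_var.
  by rewrite !inE eqxx.
- by apply: IH hF => //; apply: var_ideal_prime.
Qed.

Definition independent_mod Q (T : finType) (v : T -> S) :=
  forall c : T -> K, Q (\sum_t c t *: v t) -> forall t, c t = 0.

(** A relation modulo Q between the v t * f ^+ k is a polynomial in f.  Modulo
    Q' only its constant coefficient remains, so this coefficient vanishes; then
    f can be cancelled, as Q is prime and does not contain it. *)
Lemma independent_adjoin Q Q' f D (T : finType) (v : T -> S) :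
  is_prime Q -> is_ideal Q' -> incl Q Q' -> Q' f -> ~ Q f ->
  independent_mod Q' v ->
  independent_mod Q (fun p : T * 'I_D => v p.1 * f ^+ p.2).
Proof.
move=> Qprime Q'id QQ' Q'f Qf vQ'.
have horner : forall E (c : nat -> T -> K),
    Q (\sum_(k < E) (\sum_t c k t *: v t) * f ^+ k) ->
    forall k t, (k < E)%N -> c k t = 0.
  elim=> [//|E IH] c; rewrite big_ord_recl expr0 mulr1.
  under [X in _ + X]eq_bigr => k _ do rewrite !lift0 exprSr mulrA.
  rewrite -mulr_suml; set A := \sum_t _; set B := \sum_k _ => QAB.
  have c0 : forall t, c 0%N t = 0.
    apply: vQ'; apply: ideal_addK (QQ' _ QAB) _ => //.
    by case: Q'id => _ _; apply.
  have A0 : A = 0 by rewrite /A big1 // => t _; rewrite c0 scale0r.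
  move: QAB; rewrite A0 add0r; case: (Qprime) => _ _ PM /PM[QB|//].
  by case=> [|j] t jE //; apply: (IH (fun j => c j.+1)).
move=> c Qc [t k].
have := horner D (fun j t => oapp (fun i : 'I_D => c (t, i)) 0 (insub j)).
move=> /(_ _ k t (ltn_ord k)); rewrite valK; apply.
congr Q : Qc; symmetry.
transitivity (\sum_(j < D) \sum_t c (t, j) *: (v t * f ^+ j)).
  apply: eq_bigr => j _; rewrite mulr_suml; apply: eq_bigr => s _.
  by rewrite valK /= scalerAl.
by rewrite exchange_big pair_bigA; apply: eq_bigr => -[].
Qed.

Definition deg_le d := @supp_in K n (fun m => (mdeg m <= d)%N).

Lemma deg_leM d e f g : deg_le d f -> deg_le e g -> deg_le (d + e) (f * g).
Proof.
by move=> fd ge m /msuppM_le /allpairsP[[m1 m2] /= [/fd ? /ge ? ->]]; rewrite mdegD leq_add.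
Qed.

Lemma deg_leX d f k : deg_le d f -> deg_le (d * k) (f ^+ k).
Proof.
move=> fd; elim: k => [|k IH]; last by rewrite exprS mulnS; apply: deg_leM.
by rewrite expr0 -mpolyX0; apply/supp_inX; rewrite mdeg0.
Qed.

(** The constant e does not depend on D: it is the sum of bounds for the degrees
    of the elements chosen in the steps of the chain. *)
Lemma prime_chain_independent h (Q : nat -> S -> Prop) :
  (forall i, (i <= h)%N -> is_prime (Q i)) ->
  (forall i, (i < h)%N -> incl (Q i) (Q i.+1) /\ ~ incl (Q i.+1) (Q i)) ->
  exists e, forall D, exists (T : finType) (v : T -> S),
    [/\ #|T| = (D ^ h)%N, independent_mod (Q 0%N) v & forall t, deg_le (e * D) (v t)].
Proof.
elim: h Q => [|h IH] Q Qprime Qchain.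
  exists 0%N => D; exists unit, (fun=> 1); split; first by rewrite card_unit.
    move=> c; rewrite (bigD1 tt) //= big1 => [|[] //]; rewrite addr0 => Qc [].
    have [Qid Q1 _] := Qprime 0%N isT; apply/eqP/idPn => c0; apply: Q1.
    have <- : (c tt)^-1%:MP * (c tt *: (1 : S)) = 1.
      by rewrite mul_mpolyC scalerA mulVf // scale1r.
    by case: Qid => _ _; apply.
  by move=> _; rewrite -mpolyX0; apply/supp_inX; rewrite mdeg0.
have [e He] := IH (fun i => Q i.+1) (fun i => Qprime i.+1) (fun i => Qchain i.+1).
have [Q01 Q10] := Qchain 0%N isT.
have [f fN] := not_all_ex_not _ _ Q10; have [Q1f Q0f] := imply_to_and _ _ fN.
exists (e + msize f)%N => D; have [T [v [cT vQ vd]]] := He D.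
exists (T * 'I_D)%type, (fun p : T * 'I_D => v p.1 * f ^+ p.2); split.
- by rewrite card_prod cT card_ord expnSr.
- apply: independent_adjoin Q01 Q1f Q0f vQ; first exact: Qprime.
  by apply/prime_ideal/Qprime.
- move=> [t k] /= m mf; rewrite mulnDl; apply: leq_trans (_ : e * D + msize f * k <= _)%N.
    by apply: deg_leM mf => //; apply: deg_leX => u /msize_mdeg_lt/ltnW.
  by rewrite leq_add2l leq_mul2l (ltnW (ltn_ord k)) orbT.
Qed.

(** There are (d + 1)^n monomials with all exponents at most d; the matrix A of
    the coefficients of the v t has more rows than columns. *)
Lemma linear_dependence (T : finType) (v : T -> S) d :
  (forall t, deg_le d (v t)) -> (d.+1 ^ n < #|T|)%N ->
  exists c : T -> K, \sum_t c t *: v t = 0 /\ exists t, c t != 0.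
Proof.
move=> vd lt_dT; pose M := {ffun 'I_n -> 'I_d.+1}.
pose A := \matrix_(i < #|T|, j < #|{: M}|)
  (v (enum_val i))@_[multinom (enum_val j k : nat) | k < n].
have : kermx A != 0.
  rewrite kermx_eq0; apply/negP=> /eqP rA; have := rank_leq_col A.
  by rewrite rA card_ffun !card_ord leqNgt lt_dT.
case/matrix0Pn=> i [j Aij]; exists (fun t => kermx A i (enum_rank t)); split; last first.
  by exists (enum_val j); rewrite enum_valK.
apply/mpolyP=> m; rewrite mcoeff0 linear_sum /=.
have [md|] := boolP [forall k, m k < d.+1]%N; last first.
  case/forallPn=> k; rewrite -leqNgt => dk; rewrite big1 // => t _.
  rewrite mcoeffZ memN_msupp_eq0 ?mulr0 //; apply/negP=> /vd; rewrite leqNgt.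
  by rewrite (leq_trans dk) // mdegE (bigD1 k) ?leq_addr.
pose J : M := [ffun k => Ordinal (forallP md k)].
have := congr1 (fun B : 'M_(_, _) => B i (enum_rank J)) (mulmx_ker A).
rewrite !mxE (reindex_onto enum_rank enum_val) => [|s _]; last by rewrite enum_valK.
move=> /= AJ; rewrite -[RHS]AJ; apply: eq_big => [t|t _]; first by rewrite enum_rankK eqxx.
rewrite mcoeffZ !mxE !enum_rankK; congr (_ * _@__).
by apply/mnmP=> k; rewrite mnmE ffunE.
Qed.

Lemma prime_height_le_nvars P h : prime_height_ge P h -> (h <= n)%N.
Proof.
case=> Q [Qprime Qchain _]; rewrite leqNgt; apply/negP=> lt_nh.
have [e He] := prime_chain_independent Qprime Qchain.
(* With this D, D ^ n.+1 > (e.+1 * D) ^ n >= (e * D).+1 ^ n. *)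
pose D := (e.+1 ^ n).+1; have [T [v [cT vQ vd]]] := He D.
have [|c [c0 [t /eqP[]]]] := linear_dependence vd; last first.
  by apply: vQ; rewrite c0; case: (Qprime 0%N isT) => -[].
have D_gt0 : (0 < D)%N by [].
rewrite cT; apply: leq_trans (leq_pexp2l D_gt0 lt_nh); rewrite expnS.
apply: leq_ltn_trans (_ : (e.+1 ^ n * D ^ n < _)%N); last by rewrite ltn_pmul2r ?expn_gt0.
by rewrite -expnMn; case: (posnP n) => [->|n0] //; rewrite leq_exp2r // mulSn -add1n leq_add2r.
Qed.

(** The induction adds to F, and to the chain, the variables outside F; this
    reduces the bound to [prime_height_le_nvars]. *)
Lemma height_var_ideal_le F h : prime_height_ge (var_ideal F : S -> Prop) h -> (h <= #|F|)%N.
Proof.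
move: {2}#|_| (erefl #|~: F|) => k; elim: k F h => [|k IH] F h FCk hF.
  have := cardsC F; rewrite FCk addn0 card_ord => ->; exact: prime_height_le_nvars hF.
have /card_gt0P[i] : (0 < #|~: F|)%N by rewrite FCk.
rewrite inE => iF; have := IH (i |: F) h.+1; rewrite cardsU1 iF add1n ltnS; apply.
  by apply/eqP; rewrite -eqSS -FCk (cardsD1 i (~: F)) inE iF setCU setIC -setDE.
apply: prime_height_geS hF; first exact: var_ideal_prime.
  apply: var_ideal_incl => [|j jF]; first exact: ideal_gen_ideal.
  by apply/var_ideal_var; rewrite !inE jF orbT.
move/(_ 'X_i) => iN; case/negP: iF; apply/var_ideal_var/iN/var_ideal_var.
by rewrite !inE eqxx.
Qed.

End Heights.

(** * Matroidal ideals and their bases *)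

Section SquarefreeMonomials.
Variables (K : fieldType) (n : nat).
Local Notation S := {mpoly K[n]}.
Implicit Types (I J P Q : S -> Prop) (f g s : S) (m u : 'X_{1..n}) (A B F : {set 'I_n}).

Definition msupport m : {set 'I_n} := [set i | m i != 0%N].
Definition mset A : 'X_{1..n} := [multinom (i \in A : nat) | i < n].

Lemma mset_le A m : (mset A <= m)%MM = (A \subset msupport m).
Proof.
apply/mnm_lepP/subsetP => Am i; last first.
  by rewrite mnmE; case: (boolP (i \in A)) => //= /Am; rewrite inE lt0n.
by move=> iA; have := Am i; rewrite mnmE iA inE lt0n.
Qed.

Lemma msupportD m u : msupport (m + u)%MM = msupport m :|: msupport u.
Proof. by apply/setP=> i; rewrite !inE mnmDE addn_eq0 negb_and. Qed.

Lemma fdeg_mset F A : fdeg F (mset A) = #|F :&: A|.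
Proof.
rewrite /fdeg -sum1_card [RHS]big_mkcond [LHS]big_mkcond; apply: eq_bigr => i _.
by rewrite inE mnmE; case: (i \in F) => //; case: (i \in A).
Qed.

Lemma mpolyX_mset A : 'X_[mset A] = \prod_(i in A) 'X_i :> S.
Proof.
rewrite mpolyXE_id [RHS]big_mkcond; apply: eq_bigr => i _.
by rewrite mnmE; case: (i \in A); rewrite ?expr1 ?expr0.
Qed.

Lemma mset_supportK m : (forall i, (m i <= 1)%N) -> mset (msupport m) = m.
Proof. by move=> m1; apply/mnmP=> i; rewrite mnmE inE; case: (m i) (m1 i) => [|[]]. Qed.

Definition generated_by_sets I (Bs : {set {set 'I_n}}) :=
  forall f, I f <-> supp_in (fun m => exists2 B, B \in Bs & B \subset msupport m) f.

Lemma generated_by_sets_ideal I Bs : generated_by_sets I Bs -> is_ideal I.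
Proof.
move=> IB.
suff [L0 LD LM] : is_ideal
    (@supp_in K n (fun m => exists2 B, B \in Bs & B \subset msupport m)).
  split=> [|f g|f g]; rewrite !IB //; [exact: LD|exact: LM].
apply: supp_in_ideal => m u [B BB Bu]; exists B => //.
by rewrite msupportD (subset_trans Bu) ?subsetUr.
Qed.

Lemma generated_by_setsX I Bs m : generated_by_sets I Bs ->
  I 'X_[m] <-> exists2 B, B \in Bs & B \subset msupport m.
Proof. by move=> IB; rewrite IB supp_inX. Qed.

Lemma lem_mdeg_eq m u : (u <= m)%MM -> (mdeg m <= mdeg u)%N -> u = m.
Proof.
move=> um; rewrite -{1}(submK um) mdegD -[X in (_ <= X)%N]add0n leq_add2r leqn0.
rewrite mdeg_eq0 => /eqP E.
by rewrite -(submK um) E add0m.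
Qed.

(** Divisibility is well founded on monomials; the degree is the measure. *)
Lemma exists_min_gen I m : I 'X_[m] -> exists2 u, min_gen I u & (u <= m)%MM.
Proof.
move: {2}_.+1 (ltnSn (mdeg m)) => N; elim: N m => // N IH m mN Im.
case: (classic (min_gen I m)) => [mm|mN']; first by exists m; rewrite ?lepm_refl.
case: (classic (exists v, [/\ I 'X_[v], (v <= m)%MM & v <> m])) => [[v [Iv vm vN]]|none].
  have [|u uI uv] := IH v _ Iv; last by exists u => //; apply: lepm_trans uv vm.
  by rewrite -ltnS; apply: leq_trans mN; rewrite ltnS ltnNge; apply/negP=> /(lem_mdeg_eq vm).
case: mN'; split=> // v Iv vm; apply: NNPP => vN; apply: none.
by exists v.
Qed.

(** The bases are the supports of the minimal generators, which are squarefree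
    of the same degree. *)
Lemma matroidal_bases I : matroidal I -> (exists2 f, I f & f != 0) ->
  exists Bs : {set {set 'I_n}},
    [/\ Bs != set0, {in Bs &, forall A B, #|A| = #|B|}, exchange Bs
      & generated_by_sets I Bs].
Proof.
move=> [[[M IM] [d Id] Iex] [_ Isq]] [f0 If0 f0N].
pose Bs : {set {set 'I_n}} := [set B | excluded_middle_informative (min_gen I (mset B))].
have BsP B : reflect (min_gen I (mset B)) (B \in Bs) by rewrite inE; apply: sumboolP.
have Iid : is_ideal I.
  have [J0 JD JM] := @ideal_gen_ideal K n (fun f => exists2 m, M m & f = 'X_[m]).
  by split=> [|f g|f g]; rewrite !IM; [exact: J0|exact: JD|exact: JM].
have IB : generated_by_sets I Bs.
  move=> f; split=> [If m mf|fB].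
    have [u Mu um] := (ideal_gen_monomials f (fun g => iff_refl _)).1 ((IM f).1 If) m mf.
    have [|v vI vu] := @exists_min_gen I u; first by apply/IM/mem_ideal_gen; exists u.
    have vE := mset_supportK (Isq v vI); exists (msupport v); first by apply/BsP; rewrite vE.
    by rewrite -mset_le vE; apply: lepm_trans vu um.
  apply: ideal_monomials => // m /fB[B /BsP[IB _] Bm].
  by apply: ideal_X_le IB; rewrite ?mset_le.
exists Bs; split=> //.
- case E: (msupp f0) => [|m r]; first by rewrite -msupp_eq0 E in f0N.
  have [|B BB _] := (IB f0).1 If0 m; first by rewrite E mem_head.
  by apply/set0Pn; exists B.
- move=> A B /BsP/Id dA /BsP/Id; rewrite -dA -!fdegT !fdeg_mset !setTI.
  by move->.
- move=> A B x /BsP AB /BsP BB xA xB.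
  have [|j jAB jB] := Iex _ _ x AB BB; first by rewrite !mnmE xA (negPf xB).
  have jA : j \notin A by move: jAB; rewrite !mnmE; case: (j \in A); case: (j \in B).
  have jB' : j \in B by move: jAB; rewrite !mnmE; case: (j \in A); case: (j \in B).
  exists j; first by rewrite inE jA.
  apply/BsP; congr min_gen: jB; apply/mnmP=> i.
  rewrite mnmDE mnmBE !mnmE !inE (eq_sym i j) (eq_sym i x).
  have [<-|_] := eqVneq j i; first by rewrite (negPf jA).
  by have [<-|_] := eqVneq x i; rewrite ?xA ?subn0 addn0.
Qed.

(** * Products of ideals of variables *)

Lemma msupport_sum_le (T : finType) (c : T -> 'I_n) m (F : T -> {set 'I_n}) :
  (forall i j, i != j -> [disjoint F i & F j]) ->
  (forall i, c i \in F i) -> (forall i, m (c i) != 0%N) -> (\sum_i U_(c i) <= m)%MM.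
Proof.
move=> Fdis cF mc; apply/mnm_lepP=> k; rewrite mnm_sumE.
have [/existsP[i /eqP ck]|/existsPn none] := boolP [exists i, c i == k]; last first.
  by rewrite big1 // => i _; rewrite mnm1E (negPf (none i)).
rewrite (bigD1 i) //= mnm1E ck eqxx big1 ?lt0n -?ck // => j ji; rewrite mnm1E.
case: eqP => // cji; have := cF j; rewrite cji.
by rewrite (disjointFl (Fdis _ _ ji) (cF i)).
Qed.

Lemma fdeg_sum (T : finType) (p : pred T) (u : T -> 'X_{1..n}) F :
  fdeg F (\sum_(i | p i) u i)%MM = (\sum_(i | p i) fdeg F (u i))%N.
Proof.
elim/big_rec2: _ => [|i k m _ <-]; last by rewrite fdegD.
by rewrite /fdeg big1 // => i _; rewrite mnm0E.
Qed.

Lemma ideal_mul_min I J L : is_ideal L -> (forall f g, I f -> J g -> L (f * g)) ->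
  incl (ideal_mul I J) L.
Proof. by move=> Lid IJ; apply: ideal_gen_min => // _ [f [g [If Jg ->]]]; apply: IJ. Qed.

Lemma prod_ideal_mem (T : finType) (J : T -> S -> Prop) (f : T -> S) :
  (forall i, J i (f i)) ->
  (\big[@ideal_mul K n/@unit_ideal K n]_i J i) (\prod_i f i).
Proof.
move=> Jf; elim/big_rec2: _ => // i g L _ Lg; apply: mem_ideal_gen.
by exists (f i), g.
Qed.

Lemma prod_ideal_ideal (T : Type) (r : seq T) (J : T -> S -> Prop) :
  is_ideal (\big[@ideal_mul K n/@unit_ideal K n]_(i <- r) J i).
Proof. by elim/big_rec: _ => // i L _ _; apply: ideal_gen_ideal. Qed.

Lemma prod_ideal_sub (T : finType) (J : T -> S -> Prop) i :
  (forall i, is_ideal (J i)) ->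
  incl (\big[@ideal_mul K n/@unit_ideal K n]_i J i) (J i).
Proof.
move=> Jid; have := mem_index_enum i; elim: (index_enum T) => // j r IH.
rewrite inE big_cons => /predU1P[<-|/IH Jr]; apply: ideal_mul_min => // f g.
  by move=> Jf _; rewrite mulrC; case: (Jid i) => _ _; apply.
by move=> _ /Jr; case: (Jid i) => _ _; apply.
Qed.

Lemma transversal_monomial (T : finType) (F : T -> {set 'I_n}) m :
  (forall i j, i != j -> [disjoint F i & F j]) ->
  (forall i, 0 < fdeg (F i) m)%N ->
  exists c : T -> 'I_n, (forall i, c i \in F i) /\ (\sum_i U_(c i) <= m)%MM.
Proof.
move=> Fdis mF; have [c cP] : exists c : T -> 'I_n, forall i, c i \in F i /\ m (c i) != 0%N.
  apply: (@fin_all_exists T (fun=> 'I_n) (fun i k => k \in F i /\ m k != 0%N)) => i.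
  by have /fdeg_gt0[k kF mk] := mF i; exists k.
by exists c; split=> [i|]; [case: (cP i)|apply: msupport_sum_le Fdis _ _ => i; case: (cP i)].
Qed.

Lemma fdeg_transversal (T : finType) (F : T -> {set 'I_n}) (c : T -> 'I_n) (p : pred T) i :
  (forall i j, i != j -> [disjoint F i & F j]) ->
  (forall i, c i \in F i) -> fdeg (F i) (\sum_(j | p j) U_(c j))%MM = p i.
Proof.
move=> Fdis cF; rewrite fdeg_sum; have cFi j : j != i -> fdeg (F i) U_(c j)%MM = 0%N.
  by move=> ji; rewrite fdeg1 (disjointFr (Fdis _ _ ji) (cF j)).
have [pi|pi] := boolP (p i); last first.
  by rewrite big1 // => j pj; apply: cFi; apply: contraNneq pi => <-.
by rewrite (bigD1 i) //= fdeg1 cF big1 // => j /andP[_ /cFi].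
Qed.

End SquarefreeMonomials.

Section DisjointProducts.
Variables (K : fieldType) (n : nat) (T : finType) (F : T -> {set 'I_n}).
Local Notation S := {mpoly K[n]}.
Implicit Types (I J P Q : S -> Prop) (f g s : S) (m u : 'X_{1..n}).
Hypothesis Fdis : forall i j, i != j -> [disjoint F i & F j].
Variable I : S -> Prop.
Hypothesis IF : ideal_eq I (\big[@ideal_mul K n/@unit_ideal K n]_i var_ideal (F i)).

Lemma disjoint_product_X (c : T -> 'I_n) : (forall i, c i \in F i) -> I (\prod_i 'X_(c i)).
Proof. by move=> cF; apply/IF/prod_ideal_mem => i; apply/var_ideal_var. Qed.

Lemma disjoint_product_ideal : is_ideal I.
Proof.
have [L0 LD LM] := prod_ideal_ideal (index_enum T) (fun i => var_ideal (F i) : S -> Prop).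
by split=> [|f g|f g]; rewrite !IF; [exact: L0|exact: LD|exact: LM].
Qed.

Lemma disjoint_product_sub i : incl I (deg_ge (F i) 1).
Proof.
move=> f /IF fI; apply/var_ideal_deg.
apply: (prod_ideal_sub (J := fun j => var_ideal (F j)) i _ fI).
by move=> j; apply: ideal_gen_ideal.
Qed.

Lemma ideal_exp_ideal J k : is_ideal (ideal_exp J k).
Proof. by case: k => [|k] //; apply: ideal_gen_ideal. Qed.

Lemma ideal_exp_deg_ge J (G : {set 'I_n}) d k :
  incl J (deg_ge G d) -> incl (ideal_exp J k) (deg_ge G (k * d)).
Proof.
move=> Jd; elim: k => [|k IH]; first by move=> f _ m.
apply: ideal_mul_min => [|f g /Jd fd /IH gk]; first exact: deg_ge_ideal.
by rewrite mulSn; apply: deg_geM.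
Qed.

(** A monomial of degree at least k in each F i is divisible by a product of
    variables, one from each F i; as the F i are disjoint, the quotient has degree
    at least k - 1 in each of them. *)
Lemma disjoint_product_exp k f : ideal_exp I k f <-> forall i, deg_ge (F i) k f.
Proof.
split=> [fk i|fk].
  by have := ideal_exp_deg_ge (disjoint_product_sub i) fk; rewrite muln1.
apply: ideal_monomials => [|m mf]; first exact: ideal_exp_ideal.
have {f fk mf} : forall i, (k <= fdeg (F i) m)%N by move=> i; apply: fk.
elim: k m => [//|k IH] m mk.
have [i|c [cF cm]] := transversal_monomial Fdis (m := m); first by apply: leq_trans (mk i).
rewrite -(submK cm) addmC mpolyXD; apply: mem_ideal_gen.
exists 'X_[\sum_i U_(c i)], 'X_[m - \sum_i U_(c i)]; split=> //.
  by rewrite -mprodXE; apply: disjoint_product_X.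
apply: IH => i; have := mk i; rewrite -{1}(submK cm) fdegD.
by rewrite (fdeg_transversal predT i Fdis cF) addn1 ltnS.
Qed.

Lemma disjoint_product_deg f : I f <-> forall i, deg_ge (F i) 1 f.
Proof.
split=> [If i|f1]; first exact: disjoint_product_sub If.
have /disjoint_product_exp : forall i, deg_ge (F i) 1 f by [].
apply: ideal_mul_min => [|g h Ig _]; first exact: disjoint_product_ideal.
by rewrite mulrC; case: disjoint_product_ideal => _ _; apply.
Qed.

Hypothesis F0 : forall i, F i != set0.

(** The witness is a product of variables, one from each F j with j different
    from i. *)
Lemma disjoint_product_ass i : is_ass I (var_ideal (F i)).
Proof.
split; first exact: var_ideal_prime.
have [c cF] : exists c : T -> 'I_n, forall j, c j \in F j.
  by apply: (@fin_all_exists T (fun=> 'I_n) (fun j k => k \in F j)) => j; apply/set0Pn.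
exists 'X_[\sum_(j | j != i) U_(c j)] => g.
rewrite disjoint_product_deg var_ideal_deg; split=> [gi j|/(_ i)].
  have [_ _ FM] := deg_ge_ideal K (F j) 1.
  have [->|ji] := eqVneq j i.
    by rewrite mulrC; have [_ _] := deg_ge_ideal K (F i) 1; apply.
  by apply: FM; apply/supp_inX; rewrite (fdeg_transversal (predC1 i) j Fdis cF) /= ji.
rewrite mulrC; apply: deg_ge_cancel; rewrite /deg_ge supp_inX.
by rewrite (fdeg_transversal (predC1 i) i Fdis cF) /= eqxx.
Qed.

Lemma ideal_exp_symbolic J k : is_ideal J -> incl (ideal_exp J k) (symbolic_power J k).
Proof.
move=> Jid f fk P [[_ P1 _] _]; exists 1; split=> //.
by case: (ideal_exp_ideal J k) => _ _; apply.
Qed.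

Theorem disjoint_product_symbolic k : ideal_eq (symbolic_power I k) (ideal_exp I k).
Proof.
move=> f; split=> [fk|]; last exact: ideal_exp_symbolic disjoint_product_ideal _.
apply/disjoint_product_exp => i.
have [s [sP /disjoint_product_exp/(_ i)]] := fk _ (disjoint_product_ass i).
by apply: deg_ge_cancel; rewrite -var_ideal_deg.
Qed.

End DisjointProducts.

(** * Equality of ordinary and symbolic squares *)

Section SymbolicToTriangleFree.
Variables (K : fieldType) (n : nat).
Local Notation S := {mpoly K[n]}.
Implicit Types (I J P Q : S -> Prop) (f g s : S) (m u : 'X_{1..n}) (A B F : {set 'I_n}).

(** After removal of the terms of g lying in I, the leading monomial of g * g is
    the square of the leading monomial of g and has the same support. *)
Lemma generated_by_sets_radical I Bs g : generated_by_sets I Bs -> I (g * g) -> I g.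
Proof.
move=> IB Igg; pose p m := [exists B in Bs, B \subset msupport m].
have pP m : reflect (exists2 B, B \in Bs & B \subset msupport m) (p m).
  by apply: (iffP exists_inP).
have Iid := generated_by_sets_ideal IB; have [_ ID IM] := Iid.
have gE := restrict_split p g; set g1 := restrict p g in gE; set g0 := restrict _ g in gE.
have Ig1 : I g1 by apply/IB => m /restrict_supp[/pP].
have Ig00 : I (g0 * g0).
  apply: (@ideal_addK _ _ _ _ (g0 * g1 + g1 * g)) => //.
    by have -> : g0 * g0 + (g0 * g1 + g1 * g) = g * g by rewrite gE; ring.
  by apply: ID; [|rewrite mulrC]; apply: IM.
suff -> : g = g1 by [].
rewrite gE; have [->|g0N] := eqVneq g0 0; first by rewrite addr0.
have [/negP pN _] := restrict_supp (mlead_supp g0N); case: pN.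
apply/pP; have [] := (IB _).1 Ig00 (mlead (g0 * g0)); first by rewrite mlead_supp ?mulf_neq0.
by move=> B BB; rewrite mleadM // msupportD setUid; exists B.
Qed.

Lemma ass_var_set I Bs P : generated_by_sets I Bs -> is_ass I P ->
  exists F, (forall i, i \in F <-> P 'X_i) /\ forall A, A \in Bs -> exists2 i, i \in A & i \in F.
Proof.
move=> IB [Pprime [g Pg]].
pose F : {set 'I_n} := [set i | excluded_middle_informative (P 'X_i)].
have FP i : i \in F <-> P 'X_i by rewrite inE; split => /sumboolP.
exists F; split=> // A AB; have [_ _ IM] := generated_by_sets_ideal IB.
have [|i iA /FP iF] := @prime_prod K n P _ A (fun i => 'X_i) Pprime; last by exists i.
rewrite -mpolyX_mset; apply/Pg; rewrite mulrC; apply: IM.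
by apply/(generated_by_setsX _ IB); exists A; rewrite // -mset_le lepm_refl.
Qed.

(** Write an associated prime P as I : g.  As I is radical, g is not in P; since
    g * P is contained in I, the square of g carries the product of any two
    elements of P into I^2.  Moreover the variables in P meet every basis. *)
Lemma symbolic_square_monomial I Bs m : generated_by_sets I Bs ->
  (forall F, (forall A, A \in Bs -> exists2 i, i \in A & i \in F) -> (2 <= fdeg F m)%N) ->
  symbolic_power I 2 'X_[m].
Proof.
move=> IB m2 P Pass; have [F [FP FB]] := ass_var_set IB Pass.
have [[Pid P1 PM] [g Pg]] := Pass.
have gP : ~ P g by move=> /Pg/(generated_by_sets_radical IB) Ig; apply: P1; apply/Pg; rewrite mul1r.
have /fdeg_gt0[i iF mi] : (0 < fdeg F m)%N by apply: leq_trans (m2 F FB).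
have im : (U_(i) <= m)%MM by rewrite lep1mP.
have /fdeg_gt0[j jF mj] : (0 < fdeg F (m - U_(i))%MM)%N.
  by have := m2 F FB; rewrite -{1}(submK im) fdegD fdeg1 iF addn1.
have jm : (U_(j) <= m - U_(i))%MM by rewrite lep1mP.
exists (g * g); split=> [/PM[]//|].
rewrite -(submK im) -(submK jm) !mpolyXD.
have -> : g * g * ('X_[m - U_(i) - U_(j)] * 'X_j * 'X_i) =
   'X_[m - U_(i) - U_(j)] * (('X_i * g) * (('X_j * g) * 1)) by ring.
have [_ _ I2M] := ideal_exp_ideal I 2; apply: I2M.
apply: mem_ideal_gen; exists ('X_i * g), ('X_j * g * 1); split=> //; first by apply/Pg/FP.
by apply: mem_ideal_gen; exists ('X_j * g), 1; split=> //; apply/Pg/FP.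
Qed.

Theorem symbolic_triangle_free I (Bs : {set {set 'I_n}}) : generated_by_sets I Bs ->
  {in Bs &, forall A B, #|A| = #|B|} ->
  incl (symbolic_power I 2) (ideal_exp I 2) -> triangle_free Bs.
Proof.
move=> IB cB I2 B e a b BB eB aB bB A1B A2B; apply/eqP/idPn => ab.
(* This is x_W^2 x_a x_b x_e for W = B :\ a :\ b. *)
pose m := (mset B + mset (B :\ a :\ b) + U_(e))%MM.
have fm F : fdeg F m = (#|F :&: B| + #|F :&: (B :\ a :\ b)| + (e \in F))%N.
  by rewrite !fdegD !fdeg_mset fdeg1.
have cBab : #|B| = (#|B :\ a :\ b|).+2.
  by rewrite (cardsD1 a B) aB (cardsD1 b (B :\ a)) !inE bB eq_sym ab.
have Id : incl I (deg_ge setT #|B|).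
  move=> f /IB fB u /fB[A AB]; rewrite -mset_le => Au.
  by rewrite -(submK Au) fdegD (fdeg_mset setT) setTI (cB _ _ BB AB) leq_addl.
have /I2/(ideal_exp_deg_ge Id)/supp_inX : symbolic_power I 2 'X_[m]; last first.
  rewrite fm !setTI inE cBab; lia.
apply: symbolic_square_monomial IB _ => F FB; rewrite fm.
have meet A i : i \in A -> i \in F -> (0 < #|F :&: A|)%N.
  by move=> iA iF; apply/card_gt0P; exists i; rewrite inE iA iF.
have [i iB iF] := FB B BB; have B0 := meet _ _ iB iF.
(* F meets B, B - a + e and B - b + e, so it contains two of a, b, e unless
   it meets W, whose variables count twice. *)
have [eF|eF] := boolP (e \in F); first by rewrite addn1 ltnS addn_gt0 B0.
have [/existsP[w wBF]|/existsPn none] := boolP [exists w, w \in F :&: (B :\ a :\ b)].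
  rewrite inE in wBF; case/andP: wBF => wF wB.
  by rewrite addn0; apply: (leq_add B0); apply: meet wB wF.
have bF : b \in F.
  have [j] := FB _ A1B; rewrite !inE => /predU1P[->|/andP[ja jB] jF]; first by rewrite (negPf eF).
  by have := none j; rewrite !inE ja jB jF !andbT negbK => /eqP <-.
have aF : a \in F.
  have [j] := FB _ A2B; rewrite !inE => /predU1P[->|/andP[jb jB] jF]; first by rewrite (negPf eF).
  by have := none j; rewrite !inE jb jB jF !andbT negbK => /eqP <-.
apply: leq_trans (_ : #|[set a; b]| <= _)%N; first by rewrite cards2 ab.
rewrite -addnA; apply: leq_trans (leq_addr _ _); apply: subset_leq_card.
by apply/subsetP=> x; rewrite !inE => /orP[]/eqP->; rewrite ?aF ?bF.
Qed.

End SymbolicToTriangleFree.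

(** * Setting variables to 0 and 1 *)

Section SettingVariables.
Variables (K : fieldType) (n : nat).
Local Notation S := {mpoly K[n]}.
Implicit Types (I J P Q : S -> Prop) (f g s : S) (m u : 'X_{1..n}) (A B F Z W : {set 'I_n}).

Lemma set_varsX Z W i :
  set_vars Z W ('X_i : S) = if i \in Z then 0 else if i \in W then 1 else 'X_i.
Proof. by rewrite /set_vars comp_mpolyXU -tnth_nth tnth_mktuple. Qed.

Lemma set_vars_prod Z W (T : finType) (p : pred T) (f : T -> S) :
  set_vars Z W (\prod_(t | p t) f t) = \prod_(t | p t) set_vars Z W (f t).
Proof. exact: rmorph_prod. Qed.

Lemma set_vars_ideal_var Z W I F : [disjoint F & W] ->
  incl I (var_ideal (F :|: Z)) -> incl (set_vars_ideal Z W I) (var_ideal F).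
Proof.
move=> FW IF; apply: ideal_gen_min => [|_ [f /IF + ->]]; first exact: ideal_gen_ideal.
have [V0 VD VM] := @ideal_gen_ideal K n (fun f => exists2 i, i \in F & f = 'X_i).
move: f; apply: var_ideal_incl => [|i iFZ].
  split=> [|f g|f g]; rewrite /set_vars ?rmorph0 ?rmorphD ?rmorphM //; [exact: VD|exact: VM].
rewrite set_varsX; case: (boolP (i \in Z)) iFZ => iZ; first by rewrite inE iZ orbT.
by rewrite inE (negPf iZ) orbF => iF; rewrite (disjointFr FW iF); apply/var_ideal_var.
Qed.

(** The image of the product lies in P, and its factors are 1 or variables. *)
Lemma set_vars_prime Z W I P (T : finType) (p : pred T) (c : T -> 'I_n) : is_prime P ->
  incl (set_vars_ideal Z W I) P -> I (\prod_(t | p t) 'X_(c t)) ->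
  (forall t, p t -> c t \notin Z) -> exists t, [/\ p t, c t \notin W & P 'X_(c t)].
Proof.
move=> Pprime IP Ic cZ; have [_ P1 _] := Pprime.
have : P (\prod_(t in [set t | p t]) set_vars Z W 'X_(c t)).
  apply/IP/mem_ideal_gen; exists (\prod_(t | p t) 'X_(c t)) => //.
  by rewrite set_vars_prod; apply: eq_bigl => t; rewrite inE.
case/(prime_prod Pprime) => t; rewrite inE => pt; rewrite set_varsX (negPf (cZ t pt)).
by case: ifPn => // tW Pt; exists t.
Qed.

(** If x_i divides both, then u * (m / x_i) is a multiple of m although m / x_i
    is not. *)
Lemma regular_pair_coprime (s : seq 'X_{1..n}) m u : regular_sequence [seq 'X_[K, v] | v <- m :: u :: s] ->
  forall i, m i = 0%N \/ u i = 0%N.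
Proof.
case=> /(_ 1%N isT) /= reg _ i.
have [m0|m0] := eqVneq (m i) 0%N; first by left.
have [u0|u0] := eqVneq (u i) 0%N; first by right.
have im : (U_(i) <= m)%MM by rewrite lep1mP.
have iu : (U_(i) <= u)%MM by rewrite lep1mP.
have : ideal_of_seq [:: 'X_[K, m]] 'X_[m - U_(i)].
  apply: reg; have -> : 'X_[u] * 'X_[m - U_(i)] = 'X_[u - U_(i)] * 'X_[K, m].
    by rewrite -(submK iu) -{2}(submK im) !addmK !mpolyXD; ring.
  have [_ _ IM] := @ideal_gen_ideal K n (fun f => f \in [:: 'X_[m]]).
  by apply/IM/mem_ideal_gen; rewrite mem_head.
have incl_m : incl (ideal_of_seq [:: 'X_[K, m]]) (deg_ge setT (mdeg m)).
  apply: ideal_gen_min => [|f]; first exact: deg_ge_ideal.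
  by rewrite inE => /eqP->; apply/supp_inX; rewrite fdegT.
move/incl_m/supp_inX; rewrite fdegT -{1}(submK im) mdegD mdeg1; lia.
Qed.

(** A multiple of one of the monomials that is divisible by another one stays
    divisible by it after division by the first. *)
Lemma coprime_monomials_regular (s : seq 'X_{1..n}) :
  (forall i j, (i < j < size s)%N ->
     [disjoint msupport (nth 0%MM s i) & msupport (nth 0%MM s j)]) ->
  (forall m, m \in s -> m != 0%MM) ->
  regular_sequence [seq 'X_[K, m] | m <- s].
Proof.
move=> sdis s0.
have seqP (r : seq 'X_{1..n}) f : ideal_of_seq [seq 'X_[K, m] | m <- r] f <->
    supp_in (fun m => exists2 u, u \in r & (u <= m)%MM) f.
  by apply: ideal_gen_monomials => g; split=> [/mapP|] [m mr ->]; [exists m|apply: map_f].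
split; last first.
  move/seqP => /(_ 0%MM); rewrite msupp1 mem_head => /(_ isT)[u us /mnm_lepP u0].
  by case/eqP: (s0 u us); apply/mnmP=> i; have := u0 i; rewrite !mnm0E leqn0 => /eqP.
move=> i; rewrite size_map => ltis g; rewrite (nth_map 0%MM) // -map_take => /seqP sg.
apply/seqP => m mg; have [|u us /mnm_lepP um] := sg (nth 0%MM s i + m)%MM.
  by rewrite mcoeff_msupp mulrC mcoeffMX -mcoeff_msupp.
exists u => //; apply/mnm_lepP => k.
have /(nthP 0%MM)[j] := us; rewrite size_take ltis => ji; rewrite nth_take // => uE.
have [->|uk] := eqVneq (u k) 0%N; first by [].
have := um k; rewrite mnmDE; suff -> : nth 0%MM s i k = 0%N by [].
have dij : [disjoint msupport u & msupport (nth 0%MM s i)] by rewrite -uE sdis ?ji.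
have : k \in msupport u by rewrite inE.
by move/(disjointFr dij); rewrite inE => /negbFE/eqP.
Qed.

Lemma generated_by_sets_var I Bs F : generated_by_sets I Bs ->
  (forall B, B \in Bs -> exists2 i, i \in B & i \in F) -> incl I (var_ideal F).
Proof.
move=> IB FB f /IB fB; apply/var_ideal_deg => m /fB[B /FB[i iB iF] /subsetP/(_ i iB)].
by rewrite inE => mi; apply/fdeg_gt0; exists i.
Qed.

(** The new ideal lies in the three primes generated by two of the variables
    a, b, e, and every prime containing it contains one of these.  So its height
    is at least 2, while each of its monomials is divisible by two of a, b, e,
    and two such monomials have a common variable. *)
Theorem packed_triangle_free I (Bs : {set {set 'I_n}}) : generated_by_sets I Bs ->
  {in Bs &, forall A B, #|A| = #|B|} -> packed I -> triangle_free Bs.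
Proof.
move=> IB cB packI B e a b BB eB aB bB A1B A2B; apply/eqP/idPn => ab.
pose Z := ~: (e |: B); pose W := B :\ a :\ b.
have ea : e != a by apply: contraNneq eB => ->.
have eb : e != b by apply: contraNneq eB => ->.
have ZW : [disjoint Z & W].
  by apply/pred0P=> i /=; rewrite !inE; case: (i \in B); rewrite ?orbT ?andbF.
have I'var x y : x != y -> x \in [set a; b; e] -> y \in [set a; b; e] ->
    incl (set_vars_ideal Z W I) (var_ideal [set x; y]).
  move=> xy xabe yabe; apply: set_vars_ideal_var.
    apply/pred0P=> i /=; rewrite !inE; apply/negP=> /andP[ixy /and3P[ib ia iB]].
    have : i \in [set a; b; e] by case/orP: ixy => /eqP->.
    by rewrite !inE (negPf ib) (negPf ia) /= => /eqP ie; rewrite -ie iB in eB.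
  apply: generated_by_sets_var IB _ => D DB.
  have sub i : i \in [set a; b; e] -> i \in e |: B.
    by rewrite !inE => /orP[/orP[]/eqP->|->]; rewrite ?aB ?bB ?orbT.
  have [/existsP[i /andP[iD iF]]|/existsPn none] :=
      boolP [exists i, (i \in D) && (i \in [set x; y] :|: Z)].
    by exists i.
  have : D \subset (e |: B) :\ x :\ y.
    apply/subsetP=> i iD; have := none i; rewrite iD !inE.
    by case: (i == x); case: (i == y); case: (i == e); case: (i \in B).
  move/subset_leq_card; rewrite (cB _ _ DB BB).
  have := cardsU1 e B; rewrite eB (cardsD1 x) (sub _ xabe) (cardsD1 y) in_setD1.
  by rewrite eq_sym xy (sub _ yabe) !add1n => -[<-]; rewrite ltnn.
have I'prime P : is_prime P -> incl (set_vars_ideal Z W I) P ->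
    exists F, #|F| = 2 /\ incl (var_ideal F) P.
  move=> Pprime IP.
  have pick A : A \in Bs -> A \subset e |: B ->
      exists i, [/\ i \in A, i \in [set a; b; e] & P 'X_i].
    move=> AB Ae; have [||i [iA iW Pi]] := @set_vars_prime Z W I P _ (mem A) id Pprime IP.
    - rewrite -mpolyX_mset; apply/(generated_by_setsX _ IB); exists A => //.
      by rewrite -mset_le lepm_refl.
    - by move=> i iA; rewrite inE negbK (subsetP Ae).
    - exists i; split=> //; have := subsetP Ae i iA; move: iW; rewrite !inE.
      by case: (i == a); case: (i == b); case: (i == e); case: (i \in B).
  have A1e : e |: (B :\ a) \subset e |: B by apply: setUS; apply: subsetDl.
  have A2e : e |: (B :\ b) \subset e |: B by apply: setUS; apply: subsetDl.
  have [i [iB iabe Pi]] := pick B BB (subsetUr _ _).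
  have [i1 [i1B i1abe Pi1]] := pick _ A1B A1e.
  have [i2 [i2B i2abe Pi2]] := pick _ A2B A2e.
  have pair x y : x != y -> P 'X_x -> P 'X_y -> exists F, #|F| = 2 /\ incl (var_ideal F) P.
    move=> xy Px Py; exists [set x; y]; rewrite cards2 xy; split=> //.
    apply: var_ideal_incl => [|z]; first exact: prime_ideal.
    by rewrite !inE => /orP[]/eqP->.
  have [ia|ia] := eqVneq i a; last have [ib|ib] := eqVneq i b.
  - apply: pair Pi Pi1; rewrite ia; apply: contraNneq ea => ai1.
    by move: i1B; rewrite -ai1 !inE eqxx orbF eq_sym.
  - apply: pair Pi Pi2; rewrite ib; apply: contraNneq eb => bi2.
    by move: i2B; rewrite -bi2 !inE eqxx orbF eq_sym.
  - move: iabe; rewrite !inE (negPf ia) (negPf ib) /= => /eqP ie.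
    by rewrite -ie iB in eB.
have I'ab := I'var a b ab; have I'ae := I'var a e; have I'be := I'var b e.
rewrite !inE !eqxx ?orbT /= in I'ab I'ae I'be.
rewrite eq_sym in ea; rewrite eq_sym in eb.
have [I1|[h [[_ hlt] [s [sz sI reg]]]]] := packI Z W ZW.
  by have [_ V1 _] := var_ideal_prime K [set a; b]; apply/V1/(I'ab isT isT).
have h2 : (1 < h)%N.
  rewrite ltnNge; apply/negP=> h1; apply: hlt => P Pprime /(I'prime P Pprime)[F [F2 FP]].
  by apply: prime_height_ge_vars FP _; rewrite ?F2.
case: s sz sI reg => [|m [|u s]] sz sI reg; [by rewrite -sz in h2..|].
have mu := regular_pair_coprime reg.
have supp2 v x y : incl (set_vars_ideal Z W I) (var_ideal [set x; y]) ->
    set_vars_ideal Z W I 'X_[v] -> v x != 0%N \/ v y != 0%N.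
  move=> I'xy /I'xy/var_ideal_deg/supp_inX/fdeg_gt0[z]; rewrite !inE.
  by case/orP=> /eqP->; [left|right].
have no_pair v w : set_vars_ideal Z W I 'X_[v] -> set_vars_ideal Z W I 'X_[w] ->
    (forall i, v i = 0%N \/ w i = 0%N) -> v a = 0%N -> False.
  move=> vI wI vw va.
  have [|vb] := supp2 v _ _ (I'ab isT isT) vI; first by rewrite va.
  have [|ve] := supp2 v _ _ (I'ae ea isT isT) vI; first by rewrite va.
  have [E|wb] := vw b; first by rewrite E in vb.
  have [E|we] := vw e; first by rewrite E in ve.
  by have [] := supp2 w _ _ (I'be eb isT isT) wI; rewrite ?wb ?we.
have mI : set_vars_ideal Z W I 'X_[m] by apply: sI; rewrite mem_head.
have uI : set_vars_ideal Z W I 'X_[u] by apply: sI; rewrite !inE eqxx orbT.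
have [] := mu a; [exact: no_pair mI uI mu|apply: no_pair uI mI _ => i].
by case: (mu i); [right|left].
Qed.

End SettingVariables.

(** * Products of disjoint primes are packed *)

Section DisjointProductsPacked.
Variables (K : fieldType) (n : nat) (T : finType) (F : T -> {set 'I_n}).
Local Notation S := {mpoly K[n]}.
Hypothesis Fdis : forall i j, i != j -> [disjoint F i & F j].
Hypothesis F0 : forall i, F i != set0.
Variable I : S -> Prop.
Hypothesis IF : ideal_eq I (\big[@ideal_mul K n/@unit_ideal K n]_i var_ideal (F i)).

(** Only the F i disjoint from W, with indices in A, matter after the substitution;
    the others become the unit ideal.  Let i0 be an index in A for which G i = F i :\: Z has the
    least number h of elements.  A prime containing the image contains some
    P_(G i), and the image lies in P_(G i0), so h is the height.  It is 0 when
    some G i is empty, and then the image is the zero ideal. *)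
Theorem disjoint_product_packed : packed I.
Proof.
move=> Z W ZW; pose A := [pred i | [disjoint F i & W]].
have meetW i : ~~ A i -> exists k, k \in F i /\ k \in W.
  by case/pred0Pn=> k /andP[kF kW]; exists k.
(* For i outside A a variable of W, which becomes 1, is taken from F i. *)
have image (c : T -> 'I_n) : (forall i, A i -> c i \in F i :\: Z) ->
    set_vars_ideal Z W I 'X_[\sum_(i | A i) U_(c i)].
  move=> cA; have [c' c'P] : exists c' : T -> 'I_n, forall i,
      c' i \in F i /\ (if A i then c' i = c i else c' i \in W).
    apply: (@fin_all_exists T (fun=> 'I_n)
      (fun i k => k \in F i /\ (if A i then k = c i else k \in W))) => i.
    have [Ai|/meetW//] := boolP (A i); exists (c i); split=> //.
    by have := cA i Ai; rewrite inE => /andP[].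
  apply: mem_ideal_gen; exists (\prod_i 'X_(c' i)).
    by apply: (disjoint_product_X IF) => i; case: (c'P i).
  rewrite set_vars_prod -mprodXE big_mkcond; apply: eq_bigr => i _.
  rewrite set_varsX; have [c'F] := c'P i; have [Ai|_] := boolP (A i) => [->|c'W].
    have := cA i Ai; rewrite inE => /andP[/negPf-> cF].
    by rewrite (disjointFr Ai cF).
  by rewrite (disjointFl ZW c'W) c'W.
have [/existsP[i1 Ai1]|/existsPn noA] := boolP [exists i, A i]; last first.
  have [c cF] : exists c : T -> 'I_n, forall i, c i \in F i.
    by apply: (@fin_all_exists T (fun=> 'I_n) (fun i k => k \in F i)) => i; apply/set0Pn.
  left; have := image c; rewrite big_pred0 => [|i]; last exact/negbTE/noA.
  by rewrite mpolyX0; apply=> i; rewrite (negPf (noA i)).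
right; case: (arg_minnP (fun i => #|F i :\: Z|) Ai1) => i0 Ai0 min.
set h := #|_| in min.
have /set0Pn[x0 _] := F0 i0.
pose c j i := nth x0 (enum (F i :\: Z)) j.
have hsize j i : A i -> (j < h)%N -> (j < size (enum (F i :\: Z)))%N.
  by move=> Ai jh; rewrite -cardE (leq_trans jh) // min.
have cP j i : A i -> (j < h)%N -> c j i \in F i :\: Z.
  by move=> Ai jh; rewrite -mem_enum mem_nth // hsize.
have supp_c j k : (k \in msupport (\sum_(i | A i) U_(c j i))%MM) -> exists2 i, A i & c j i = k.
  rewrite inE mnm_sumE sum_nat_eq0 => /forall_inPn[i Ai].
  by rewrite mnm1E eqb0 negbK => /eqP <-; exists i.
exists h; split.
  split.
    move=> P Pprime IP.
    have [/existsP[i /andP[Ai /forallP iP]]|/existsPn none] :=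
        boolP [exists i, A i && [forall k, (k \in F i :\: Z) ==>
                 excluded_middle_informative (P 'X_k)]].
      apply: prime_height_ge_vars (min i Ai) => //.
      apply: var_ideal_incl => [|k kF]; first exact: prime_ideal.
      by apply/(sumboolP (excluded_middle_informative _))/(implyP (iP k)).
    (* Otherwise P misses a variable of each G i, hence also the product of
       these variables, which is in the image. *)
    have [d dP] : exists d : T -> 'I_n, forall i, A i -> d i \in F i :\: Z /\ ~ P 'X_(d i).
      apply: (@fin_all_exists T (fun=> 'I_n) (fun i k => A i -> k \in F i :\: Z /\ ~ P 'X_k)) => i.
      have [Ai|_] := boolP (A i); last by exists x0.
      have := none i; rewrite Ai => /forallPn[k]; rewrite negb_imply => /andP[kF kP].
      by exists k => _; split=> // /(sumboolP (excluded_middle_informative _)); apply/negP.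
    have [|i] := @prime_prod K n P T [set i | A i] (fun i => 'X_(d i)) Pprime.
      rewrite big_set mprodXE; apply: IP; apply: image => i /dP[]; by [].
    by rewrite inE => /dP[].
  move=> hge; suff IP : incl (set_vars_ideal Z W I) (var_ideal (F i0 :\: Z)).
    by have := height_var_ideal_le (hge _ (var_ideal_prime K _) IP); rewrite ltnn.
  apply: set_vars_ideal_var.
    by apply: disjointWl Ai0; apply: subsetDl.
  move=> f /(disjoint_product_sub IF)-/(_ i0)/var_ideal_deg.
  apply: var_ideal_incl => [|k kF]; first exact: ideal_gen_ideal.
  by apply/var_ideal_var; rewrite !inE kF andbT orbC orbN.
exists [seq (\sum_(i | A i) U_(c j i))%MM | j <- iota 0 h]; split.
- by rewrite size_map size_iota.
- move=> m /mapP[j]; rewrite mem_iota add0n => /andP[_ jh] ->.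
  by apply: image => i Ai; apply: cP.
apply: coprime_monomials_regular => [j j'|m /mapP[j]].
  rewrite size_map size_iota => /andP[jj' j'h]; have jh := ltn_trans jj' j'h.
  rewrite !(nth_map 0%N) ?size_iota // !nth_iota // !add0n.
  apply/pred0P=> k /=; apply/negP=> /andP[/supp_c[i Ai ck] /supp_c[i' Ai' c'k]].
  have ii' : i = i'.
    apply/eqP/idPn => /Fdis ii'; have := cP j i Ai jh; have := cP j' i' Ai' j'h.
    by rewrite ck c'k !inE => /andP[_ kF'] /andP[_ /(disjointFr ii')]; rewrite kF'.
  move: c'k; rewrite -ii' -ck => /eqP; rewrite /c nth_uniq ?enum_uniq ?hsize // => /eqP E.
  by rewrite E ltnn in jj'.
rewrite mem_iota add0n => /andP[_ jh] ->; apply/eqP=> /mnmP/(_ (c j i0)).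
by rewrite mnm_sumE (bigD1 i0) //= mnm0E mnm1E eqxx.
Qed.

End DisjointProductsPacked.

(** * The equivalence *)

(** The F i are the parallel classes of the elements of a basis.  Every basis
    meets every class, and conversely a monomial involving a variable from each
    class involves a transversal, which is a basis. *)
Lemma triangle_free_disjoint_product (K : fieldType) (n : nat) (I : {mpoly K[n]} -> Prop)
    (Bs : {set {set 'I_n}}) :
  Bs != set0 -> {in Bs &, forall A B : {set 'I_n}, #|A| = #|B|} -> exchange Bs ->
  triangle_free Bs -> generated_by_sets I Bs ->
  exists (t : nat) (F : 'I_t -> {set 'I_n}),
    [/\ forall i, F i != set0, forall i j, i != j -> [disjoint F i & F j]
      & ideal_eq I (\big[@ideal_mul K n/@unit_ideal K n]_(i < t) var_ideal (F i))].
Proof.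
move=> /set0Pn[B BB] cB exch noT IB.
pose F (i : 'I_#|B|) := parallel_class Bs B (enum_val i).
have Fdis i j : i != j -> [disjoint F i & F j].
  move=> ij; apply/pred0P=> k /=; apply/negP=> /andP[ki kj]; case/eqP: ij; apply: enum_val_inj.
  exact: (parallel_class_inj cB noT BB (enum_valP i) (enum_valP j) ki kj).
exists #|B|, F; split=> // [i|].
  by apply/set0Pn; exists (enum_val i); exact: (mem_parallel_class BB (enum_valP i)).
have FE := disjoint_product_deg Fdis (fun f => iff_refl _); move=> f.
rewrite FE; split=> [/IB fB i m /fB[A AB Am]|fF].
  have [e eA eF] := basis_meets_class exch BB AB (enum_valP i).
  by apply/fdeg_gt0; exists e => //; have := subsetP Am e eA; rewrite inE.
apply/IB => m mf.
pose c b := odflt b [pick k in parallel_class Bs B b | m k != 0%N].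
have cP b : b \in B -> c b \in parallel_class Bs B b /\ m (c b) != 0%N.
  move=> bB; rewrite /c; case: pickP => [k /andP[]//|none].
  have /fdeg_gt0[k kF mk] := fF (enum_rank_in bB b) m mf.
  by have := none k; rewrite mk andbT; move: kF; rewrite /F enum_rankK_in // => ->.
exists (c @: B).
  by apply: (transversal_basis exch cB noT BB) => b /cP[].
by apply/subsetP=> _ /imsetP[b /cP[_ mb] ->]; rewrite inE.
Qed.

Theorem theorem5p5 (K : fieldType) (n : nat) (I : {mpoly K[n]} -> Prop)
    (hI : matroidal I) (hI0 : exists2 f, I f & f != 0) :
  [<-> exists (t : nat) (F : 'I_t -> {set 'I_n}),
         [/\ forall i, F i != set0,
             forall i j, i != j -> [disjoint F i & F j]
           & ideal_eq I
               (\big[@ideal_mul K n/@unit_ideal K n]_(i < t)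
                  var_ideal (F i))];
       forall k : nat, (1 <= k)%N ->
         ideal_eq (symbolic_power I k) (ideal_exp I k);
       packed I].
Proof.
have [Bs [Bs0 cB exch IB]] := matroidal_bases hI hI0.
have triangle_freeP := triangle_free_disjoint_product Bs0 cB exch _ IB.
tfae=> [[t [F [F0 Fdis IF]]] k _|Isym|Ipacked].
- exact: (disjoint_product_symbolic Fdis IF F0).
- have noT := symbolic_triangle_free IB cB (fun f => (Isym 2 isT f).1).
  have [t [F [F0 Fdis IF]]] := triangle_freeP noT.
  exact: (disjoint_product_packed Fdis F0 IF).
- exact: triangle_freeP (packed_triangle_free IB cB Ipacked).
Qed.
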